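(* Any Zariski-closed $F$-subalgebra $A$ of $B$ is semiperfect.
   Context: $F\subseteq K$ are fields, $F$ finite or infinite, $K$ algebraically closed; $B$ is a finite dimensional $K$-algebra, and $n=\dim_K B$. Choosing a $K$-base of $B$, identify $B$ with the affine space $K^{n}$ and give it the Zariski topology (closed sets are the common zero sets of subsets of $K[\lambda_1,\dots,\lambda_n]$; this does not depend on the base). An $F$-subalgebra $A\subseteq B$ is Zariski-closed if it is a closed subset of $B$. $\operatorname{Rad}(A)$ is the unique largest nil ideal of $A$ (it is nilpotent, and for Zariski-closed $A$ coincides with the Jacobson radical). In this paper an algebra $A$ is called semiperfect when $\operatorname{Rad}(A)$ is nil and $A/\operatorname{Rad}(A)$ is semisimple. *)

(* Defs.v *)
From HB Require Import structures.
From mathcomp Require Import all_boot all_algebra all_field.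
From mathcomp Require Import boolp classical_sets.
From mathcomp Require Import mpoly.

Set Implicit Arguments.
Unset Strict Implicit.
Unset Printing Implicit Defensive.

Import GRing.Theory.
Local Open Scope ring_scope.
Local Open Scope quotient_scope.

(* B with scalars restricted along iota : F -> K. A field extension F \subset K
   is given as a ring morphism between fields, which is always injective. *)
Definition restrict_scalars (F K : fieldType) (iota : {rmorphism F -> K})
  (B : Type) : Type := B.

Section RestrictScalars.
Variables (F K : fieldType) (iota : {rmorphism F -> K}) (B : algType K).
Local Notation BF := (restrict_scalars iota B).

HB.instance Definition _ := GRing.NzRing.on BF.

Definition restrict_scale (a : F) (x : BF) : BF := iota a *: (x : B).

Lemma restrict_scalerA a b x :
  restrict_scale a (restrict_scale b x) = restrict_scale (a * b) x.
Proof. by rewrite /restrict_scale scalerA rmorphM. Qed.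

Lemma restrict_scale1r : left_id 1 restrict_scale.
Proof. by move=> x; rewrite /restrict_scale rmorph1 scale1r. Qed.

Lemma restrict_scalerDr : right_distributive restrict_scale +%R.
Proof. by move=> a x y; rewrite /restrict_scale scalerDr. Qed.

Lemma restrict_scalerDl x : {morph restrict_scale^~ x : a b / a + b}.
Proof. by move=> a b; rewrite /restrict_scale rmorphD scalerDl. Qed.

HB.instance Definition _ := GRing.Zmodule_isLmodule.Build F BF
  restrict_scalerA restrict_scale1r restrict_scalerDr restrict_scalerDl.

Lemma restrict_scalerAl (a : F) (x y : BF) : a *: (x * y) = (a *: x) * y.
Proof. exact: (@scalerAl K B). Qed.

HB.instance Definition _ := GRing.Lmodule_isLalgebra.Build F BF
  restrict_scalerAl.

Lemma restrict_scalerAr (a : F) (x y : BF) : a *: (x * y) = x * (a *: y).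
Proof. exact: (@scalerAr K B). Qed.

HB.instance Definition _ := GRing.Lalgebra_isAlgebra.Build F BF
  restrict_scalerAr.

End RestrictScalars.

Definition subalgebra (F : fieldType) (B : algType F) (A : subalgClosed B) :=
  {x : B | x \in A}.

Section Subalgebra.
Variables (F : fieldType) (B : algType F) (A : subalgClosed B).

HB.instance Definition _ := SubChoice.on (subalgebra A).
HB.instance Definition _ :=
  [SubChoice_isSubAlgebra of subalgebra A by <:].

End Subalgebra.

Definition zariski_closed (K : fieldType) (B : vectType K) (n : nat)
    (e : n.-tuple B) (Z : set B) : Prop :=
  exists P : set {mpoly K[n]},
    Z = [set x | forall p, P p -> p.@[fun i => coord e i x] = 0]%classic.

Definition ideal_closed (R : pzRingType) (I : {pred R}) : Prop :=
  zmod_closed I /\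
  forall a x, x \in I -> (a * x \in I) /\ (x * a \in I).

HB.mixin Record isIdeal (R : pzRingType) (I : R -> bool) := {
  ideal_closed_subproof : ideal_closed I
}.

HB.structure Definition Ideal (R : pzRingType) :=
  {I of GRing.ZmodClosed R I & isIdeal R I}.

Notation ideal := Ideal.type.

Section IdealTheory.
Variables (R : pzRingType) (I : ideal R).

Lemma ideal_mull a x : x \in I -> a * x \in I.
Proof. by case/(ideal_closed_subproof.2 a). Qed.

Lemma ideal_mulr a x : x \in I -> x * a \in I.
Proof. by case/(ideal_closed_subproof.2 a). Qed.

End IdealTheory.

(* [Quotient.quot] is a ring only over commutative rings; here its additive
   group gets a multiplication for any two-sided ideal. *)
Definition quotient_ring (R : pzRingType) (I : ideal R) := Quotient.quot I.

Section QuotientRing.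
Variables (R : pzRingType) (I : ideal R).
Local Notation Q := (quotient_ring I).

HB.instance Definition _ := GRing.Zmodule.on Q.
HB.instance Definition _ : EqQuotient R (Quotient.equiv I) Q :=
  EqQuotient.on Q.

Definition quotient_one : Q := lift_cst Q 1.
Definition quotient_mul := lift_op2 Q *%R.

Lemma quotient_piP (x y : R) : (\pi_Q x = \pi_Q y) <-> (x - y \in I).
Proof. by rewrite Quotient.idealrBE; split=> /eqP. Qed.

Lemma quotient_pi1 : \pi_Q 1 = quotient_one.
Proof. by unlock quotient_one. Qed.

Lemma quotient_piM (x y : R) :
  \pi_Q (x * y) = quotient_mul (\pi_Q x) (\pi_Q y).
Proof.
unlock quotient_mul; apply/quotient_piP.
rewrite -[x * y](addrNK (x * repr (\pi_Q y))) -mulrBr -addrA -mulrBl.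
apply: rpredD; [apply: ideal_mull | apply: ideal_mulr].
all: by apply/quotient_piP; rewrite reprK.
Qed.

Lemma quotient_piD (x y : R) : \pi_Q (x + y) = \pi_Q x + \pi_Q y.
Proof. exact: (@pi_addr _ _ _ _ _ (Quotient.quot I)). Qed.

Lemma quotient_mulA : associative quotient_mul.
Proof.
move=> x y z; rewrite -[x]reprK -[y]reprK -[z]reprK.
by rewrite -!quotient_piM mulrA.
Qed.

Lemma quotient_mul1r : left_id quotient_one quotient_mul.
Proof. by move=> x; rewrite -[x]reprK -quotient_pi1 -quotient_piM mul1r. Qed.

Lemma quotient_mulr1 : right_id quotient_one quotient_mul.
Proof. by move=> x; rewrite -[x]reprK -quotient_pi1 -quotient_piM mulr1. Qed.

Lemma quotient_mulDl : left_distributive quotient_mul +%R.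
Proof.
move=> x y z; rewrite -[x]reprK -[y]reprK -[z]reprK.
by rewrite -quotient_piD -!quotient_piM -quotient_piD mulrDl.
Qed.

Lemma quotient_mulDr : right_distributive quotient_mul +%R.
Proof.
move=> x y z; rewrite -[x]reprK -[y]reprK -[z]reprK.
by rewrite -quotient_piD -!quotient_piM -quotient_piD mulrDr.
Qed.

HB.instance Definition _ := GRing.Zmodule_isPzRing.Build Q
  quotient_mulA quotient_mul1r quotient_mulr1 quotient_mulDl quotient_mulDr.

Definition quotient_pi (x : R) : Q := \pi_Q x.

Lemma quotient_pi_zmod_morphism : zmod_morphism quotient_pi.
Proof.
move=> x y; apply/eqP; rewrite eq_sym subr_eq; apply/eqP.
by rewrite /quotient_pi -quotient_piD subrK.
Qed.

Lemma quotient_pi_monoid_morphism : monoid_morphism quotient_pi.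
Proof. by split=> [|x y]; [exact: quotient_pi1 | exact: quotient_piM]. Qed.

HB.instance Definition _ := GRing.isZmodMorphism.Build R Q quotient_pi
  quotient_pi_zmod_morphism.
HB.instance Definition _ := GRing.isMonoidMorphism.Build R Q quotient_pi
  quotient_pi_monoid_morphism.

Lemma quotient_pi_eq0 (x : R) : (quotient_pi x = 0) <-> (x \in I).
Proof. by rewrite -(rmorph0 quotient_pi) quotient_piP subr0. Qed.

Lemma quotient_pi_surj (y : Q) : exists x, quotient_pi x = y.
Proof. by exists (repr y); rewrite /quotient_pi reprK. Qed.

End QuotientRing.

Definition nil_subset (R : pzRingType) (I : {pred R}) : Prop :=
  forall x, x \in I -> exists n : nat, x ^+ n = 0.

(* The union of all nil ideals; [nilrad_largest] shows that it is the largest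
   nil ideal. *)
Definition nilrad (R : pzRingType) : {pred R} := fun x =>
  `[< exists I : {pred R}, [/\ ideal_closed I, nil_subset I & x \in I] >].

Arguments nilrad R : clear implicits.

Section NilradTheory.
Variable R : pzRingType.
Implicit Types I J : {pred R}.

Lemma nilradP (x : R) :
  x \in nilrad R <->
  exists I, [/\ ideal_closed I, nil_subset I & x \in I].
Proof. by rewrite unfold_in; split=> /asboolP. Qed.

Lemma nilrad_nil : nil_subset (nilrad R).
Proof. by move=> x /nilradP[I [_ nI /nI]]. Qed.

Lemma nil_ideal_sub_nilrad I :
  ideal_closed I -> nil_subset I -> {subset I <= nilrad R}.
Proof. by move=> iI nI x xI; apply/nilradP; exists I. Qed.

Definition ideal_sum I J : {pred R} := fun x =>
  `[< exists u v, [/\ u \in I, v \in J & x = u + v] >].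

Lemma ideal_sumP I J (x : R) :
  x \in ideal_sum I J <-> exists u v, [/\ u \in I, v \in J & x = u + v].
Proof. by rewrite unfold_in; split=> /asboolP. Qed.

Lemma ideal_sum_closed I J :
  ideal_closed I -> ideal_closed J -> ideal_closed (ideal_sum I J).
Proof.
move=> [[I0 IB] IM] [[J0 JB] JM]; split; [split|].
- by apply/ideal_sumP; exists 0, 0; rewrite addr0.
- move=> _ _ /ideal_sumP[u [v [uI vJ ->]]] /ideal_sumP[u' [v' [uI' vJ' ->]]].
  apply/ideal_sumP; exists (u - u'), (v - v').
  by split; [exact: IB | exact: JB | rewrite opprD addrACA].
- move=> a _ /ideal_sumP[u [v [uI vJ ->]]].
  have [? ?] := IM a u uI; have [? ?] := JM a v vJ.
  by split; apply/ideal_sumP; [exists (a * u), (a * v)|exists (u * a), (v * a)];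
    rewrite ?mulrDr ?mulrDl.
Qed.

Lemma ideal_sum_nil I J : ideal_closed J -> nil_subset I -> nil_subset J ->
  nil_subset (ideal_sum I J).
Proof.
move=> [[J0 JB] JM] nI nJ _ /ideal_sumP[u [v [/nI[n un0] vJ ->]]].
have JD x y : x \in J -> y \in J -> x + y \in J.
  by move=> xJ yJ; rewrite -[y]opprK JB // -sub0r JB.
have: (u + v) ^+ n - u ^+ n \in J.
  elim: n {un0} => [|n IHn]; first by rewrite subrr.
  rewrite !exprS mulrDl addrAC -mulrBr.
  by apply: JD; [case: (JM u _ IHn) | case: (JM ((u + v) ^+ n) _ vJ)].
by rewrite un0 subr0 => /nJ[m uvm0]; exists (n * m)%N; rewrite exprM.
Qed.

Lemma nilrad_ideal : ideal_closed (nilrad R).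
Proof.
split; [split|].
- apply/nilradP; exists (fun z : R => z == 0); split; rewrite ?unfold_in //.
    split; [split|] => [|x y|a x]; rewrite ?unfold_in //.
      by move=> /eqP-> /eqP->; rewrite subrr.
    by move=> /eqP->; rewrite mulr0 mul0r.
  by move=> x; rewrite unfold_in => /eqP->; exists 1%N; rewrite expr1.
- move=> x y /nilradP[I [iI nI xI]] /nilradP[J [iJ nJ yJ]].
  apply/nilradP; exists (ideal_sum I J).
  split; [exact: ideal_sum_closed | exact: ideal_sum_nil |].
  apply/ideal_sumP; exists x, (- y); split=> //.
  by case: iJ => [[J0 JB] _]; rewrite -sub0r JB.
- move=> a x /nilradP[I [iI nI xI]].
  by case: (iI.2 a x xI) => ? ?; split; apply/nilradP; exists I.
Qed.

Lemma nilrad_largest :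
  [/\ ideal_closed (nilrad R), nil_subset (nilrad R) &
   forall I, ideal_closed I -> nil_subset I -> {subset I <= nilrad R}].
Proof.
by split; [exact: nilrad_ideal|exact: nilrad_nil|exact: nil_ideal_sub_nilrad].
Qed.

HB.instance Definition _ := GRing.isZmodClosed.Build R (nilrad R)
  nilrad_ideal.1.
HB.instance Definition _ := isIdeal.Build R (nilrad R) nilrad_ideal.

End NilradTheory.

Definition simple_submodule (R : pzRingType) (M : lmodType R) (U : {pred M}) :=
  [/\ submod_closed U, exists2 x, x \in U & x != 0 &
   forall V : {pred M}, submod_closed V -> {subset V <= U} ->
     (forall x, x \in V -> x = 0) \/ {subset U <= V}].

(* M is the sum of its simple submodules. *)
Definition semisimple_module (R : pzRingType) (M : lmodType R) : Prop :=
  forall x : M, exists s : seq M,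
    x = \sum_(y <- s) y /\
    forall y, y \in s -> exists2 U : {pred M}, simple_submodule U & y \in U.

(* The submodules of the regular module R^o are the left ideals of R. *)
Definition semisimple_ring (R : pzRingType) : Prop := semisimple_module R^o.

Definition semiperfect (R : pzRingType) : Prop :=
  nil_subset (nilrad R) /\ semisimple_ring (quotient_ring (nilrad R)).

(* Main.v *)
Require Import Defs.
From mathcomp Require Import all_boot all_algebra all_field.
From mathcomp Require Import boolp classical_sets.
From mathcomp Require Import mpoly.

(** Call a ring strongly pi-regular when every element [a] satisfies
    [a ^+ r = a ^+ r.+1 * c] for some exponent [r] and some [c] commuting with
    [a]. The proof has two independent halves.

    A Zariski-closed subalgebra [A] is strongly pi-regular. For [a] in [A] the
    finite dimensional algebra [B] supplies [v], a polynomial in [a], with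
    [a ^+ r = a ^+ r.+1 * v], so that multiplication by [v] steps backwards
    along the powers [a ^+ k], [k >= r]. A polynomial function [f] on [B] lies
    in a finite dimensional space of functions stable under [x |-> v * x]; by
    Cayley-Hamilton its values along an orbit of [v] satisfy a monic linear
    recurrence, whose order [N] depends on [f] alone. If [f] vanishes on [A],
    the orbit of [a ^+ (r + N)] starts with [N] zeros, namely at powers of [a],
    so all later values vanish as well. Hence every [v ^+ j * a ^+ r] satisfies
    the equations of [A] ([zariski_closed_orbit]), and [c = v ^+ r.+1 * a ^+ r]
    is the required element ([zariski_closed_pi_regular]).

    A strongly pi-regular ring in which chains of idempotents have bounded
    length is semiperfect ([pi_regular_semiperfect]). Its Jacobson radical is
    nil, so an element [x] outside the nilradical has a left multiple which is
    not nilpotent, and pi-regularity turns that multiple into a nonzero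
    idempotent. Applied to [x * e] with [e] a primitive idempotent, this gives
    [y * (x * e) = e] for some [y] ([primitive_mull]): the left ideal generated
    by [e] becomes simple modulo the nilradical. As [1] is a sum of primitive
    idempotents, the quotient is semisimple. In a subalgebra of [B] the length
    of chains of idempotents is bounded because [\dim (f * B)] strictly
    increases along them ([limg_amull_ltn]). *)

Set Implicit Arguments.
Unset Strict Implicit.
Unset Printing Implicit Defensive.

Import GRing.Theory.
Local Open Scope ring_scope.

(** * Strongly pi-regular rings *)

Definition strongly_pi_regular (R : pzRingType) := forall a : R,
  exists r (c : R), a * c = c * a /\ a ^+ r = a ^+ r.+1 * c.

Section PiRegular.
Variable R : pzRingType.
Hypothesis piR : strongly_pi_regular R.
Implicit Types a b c e x y z : R.

(** This is the Jacobson radical: [1 - y * x] being left invertible for all [y]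
    means that [x] lies in every maximal left ideal. *)
Definition jacobson : {pred R} := fun x =>
  `[< forall y, exists z, z * (1 - y * x) = 1 >].

Lemma jacobsonP x :
  x \in jacobson <-> forall y, exists z, z * (1 - y * x) = 1.
Proof. by rewrite unfold_in; split=> /asboolP. Qed.

(** Stability on the right rests on the identity
    [(1 + p * z * b) * (1 - p * b) = 1], valid whenever
    [z * (1 - b * p) = 1]. *)
Lemma jacobson_ideal : ideal_closed jacobson.
Proof.
split; [split|].
- by apply/jacobsonP => y; exists 1; rewrite mulr0 subr0 mulr1.
- move=> x x' /jacobsonP Jx /jacobsonP Jx'; apply/jacobsonP => y.
  have [z zx] := Jx y; have [z' zx'] := Jx' (- (z * y)).
  exists (z' * z); rewrite -mulrA -[RHS]zx'; congr (_ * _).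
  by rewrite [y * _]mulrBr opprB addrCA mulrDr zx addrC mulNr opprK mulrA.
- move=> b x /jacobsonP Jx; split; apply/jacobsonP => y.
    by have [z zx] := Jx (y * b); exists z; rewrite mulrA.
  have [z] := Jx (b * y); rewrite -mulrA; set p := y * x => zp.
  exists (1 + p * z * b); rewrite mulrA -/p mulrDl mul1r.
  have -> : p * z * b * (1 - p * b) = p * (z * (1 - b * p)) * b.
    by rewrite !mulrBr !mulrBl !mulr1 !mulrA.
  by rewrite zp mulr1 subrK.
Qed.

(** With [a ^+ r = a ^+ r.+1 * c], the left invertible element [1 - c * a]
    annihilates [a ^+ r]. *)
Lemma jacobson_nil : nil_subset jacobson.
Proof.
move=> a /jacobsonP Ja; have [r [c [ac ar]]] := piR a.
have [z zc] := Ja c; exists r.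
rewrite -[LHS]mul1r -zc -mulrA mulrBl mul1r -mulrA -exprS.
rewrite [c * _](_ : _ = a ^+ r) ?subrr ?mulr0 // ar.
exact/commrX.
Qed.

(** A left ideal of nilpotent elements lies in the Jacobson radical, which is a
    nil two-sided ideal here; over an arbitrary ring this implication is the
    Koethe conjecture. *)
Lemma nilradN_mull x : x \notin nilrad R ->
  exists y, forall n, (y * x) ^+ n != 0.
Proof.
move=> xN; apply: contrapT => noy; case/negP: xN.
apply: (nil_ideal_sub_nilrad jacobson_ideal jacobson_nil).
apply/jacobsonP => y.
have [n yxn0] : exists n, (y * x) ^+ n = 0.
  apply: contrapT => yxn; apply: noy; exists y => n; apply/eqP => yxn0.
  by apply: yxn; exists n.
(* the geometric series inverts [1 - y * x] *)
exists (\sum_(i < n) (y * x) ^+ i).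
have := subrX1 (y * x) n; rewrite yxn0 sub0r => /(congr1 -%R).
rewrite opprK -mulNr opprB => yx1; rewrite [RHS]yx1.
apply/esym; apply: commr_sum => i _; apply/commrX/commr_sym.
by apply: commrB; [exact: commr1|].
Qed.

Definition is_idempotent e := e * e = e.

Definition sub_idempotent f e := [/\ is_idempotent f, f * e = f & e * f = f].

Definition primitive_idempotent e := [/\ is_idempotent e, e != 0 &
  forall f, sub_idempotent f e -> f = 0 \/ f = e].

(** Some left multiple [w] of [x * e] is not nilpotent, and neither is
    [t = e * w], which lies in the corner ring [e * R * e]. The idempotent
    [t ^+ s * c ^+ s] of that corner is nonzero, hence equals [e] by
    primitivity, and it is a left multiple of [x * e]. *)
Lemma primitive_mull e x : primitive_idempotent e -> x * e \notin nilrad R ->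
  exists y, y * (x * e) = e.
Proof.
case=> ee e0 e_prim /nilradN_mull[y xeN].
pose w := y * (x * e); pose t := e * w.
have we : w * e = w by rewrite /w -!mulrA ee.
have wt : w * t = w * w by rewrite /t mulrA we.
have et : e * t = t by rewrite /t mulrA ee.
have te : t * e = t by rewrite /t -mulrA we.
have tN n : t ^+ n != 0.
  have wE : w ^+ n.+1 = w * t ^+ n.
    elim: n => [|n IHn]; first by rewrite expr1 mulr1.
    by rewrite exprS IHn exprS [RHS](mulrA w t) wt mulrA.
  by apply: contraNneq (xeN n.+1); rewrite -/w wE => ->; rewrite mulr0.
(* [s > 0] is what puts [t ^+ s * c ^+ s] inside the corner [e * R * e] *)
have [r [c [tc tr]]] := piR t; pose s := r.+1.
have tsc : t ^+ s.+1 * c = t ^+ s by rewrite exprS -mulrA -tr -exprS.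
have ts k : t ^+ (s + k) * c ^+ k = t ^+ s.
  elim: k => [|k IHk]; first by rewrite mulr1 addn0.
  rewrite addnS -addSn addnC exprD [c ^+ _]exprS mulrA -(mulrA (t ^+ k)) tsc.
  by rewrite -exprD addnC.
have tcs : t ^+ s * c ^+ s = c ^+ s * t ^+ s by apply/commrX/commr_sym/commrX.
pose f := t ^+ s * c ^+ s.
have tf : t ^+ s * f = t ^+ s by rewrite mulrA -exprD ts.
have [||fE] := e_prim f; first split.
- by rewrite /is_idempotent {1}/f tcs -mulrA tf -tcs.
- by rewrite /f tcs -mulrA [t ^+ s]exprSr -mulrA te.
- by rewrite /f mulrA; congr (_ * _); rewrite exprS [LHS]mulrA et.
- by move=> f0; case/eqP: (tN s); rewrite -tf f0 mulr0.
exists (c ^+ s * t ^+ r * e * y).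
by rewrite -mulrA -/w -mulrA -/t -mulrA -exprSr -/s -tcs.
Qed.

(** A nonzero idempotent [e] that is not primitive splits as [f + (e - f)] with
    both summands properly below [e]; the rank [rk] makes this splitting
    terminate. *)
Lemma idempotent_sum (rk : R -> nat) :
  (forall f e, is_idempotent e -> sub_idempotent f e -> f != e ->
    (rk f < rk e)%N) ->
  forall e, is_idempotent e ->
  exists s, e = \sum_(f <- s) f /\ forall f, f \in s -> primitive_idempotent f.
Proof.
move=> rk_lt e; have [n] := ubnP (rk e); elim: n e => // n IHn e le_en ee.
have [e_prim|eN] := pselect (primitive_idempotent e).
  exists [:: e]; split; first by rewrite big_seq1.
  by move=> f; rewrite inE => /eqP->.
have [->|e0] := eqVneq e 0; first by exists [::]; rewrite big_nil.
have [f [fe f0 f1]] : exists f, [/\ sub_idempotent f e, f != 0 & f != e].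
  apply: contrapT => nof; apply: eN; split=> // f fe.
  have [->|f0] := eqVneq f 0; [by left | right].
  by apply/eqP; apply: contrapT => /negP f1; apply: nof; exists f.
have [ff fe_f ef_f] := fe.
have fe' : sub_idempotent (e - f) e.
  split; rewrite /is_idempotent.
  - by rewrite mulrBr !mulrBl ee fe_f ef_f ff subrr subr0.
  - by rewrite mulrBl ee fe_f.
  - by rewrite mulrBr ee ef_f.
have f1' : e - f != e.
  by apply: contraNneq f0 => efe; rewrite -(subKr e f) efe subrr.
have [s [sE sP]] := IHn f (leq_trans (rk_lt _ _ ee fe f1) le_en) ff.
have [gg _ _] := fe'.
have [s' [sE' sP']] :=
  IHn (e - f) (leq_trans (rk_lt _ _ ee fe' f1') le_en) gg.
exists (s ++ s'); split; first by rewrite big_cat /= -sE -sE' addrC subrK.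
by move=> g; rewrite mem_cat => /orP[/sP|/sP'].
Qed.

Definition left_multiples (Q : pzRingType) (q : Q) : {pred Q^o} := fun z : Q =>
  `[< exists y : Q, z = y * q >].

Local Notation Q := (quotient_ring (nilrad R)).

(** By [primitive_mull], any nonzero multiple of the class of [e] can be
    multiplied back to the class of [e]. *)
Lemma simple_left_multiples e : primitive_idempotent e ->
  simple_submodule
    (left_multiples (quotient_pi (nilrad R) e)).
Proof.
move=> e_prim; have [ee e0 _] := e_prim; set q := quotient_pi _ e.
have UP (z : Q) :
  z \in left_multiples q <-> exists y : Q, z = y * q.
  by rewrite unfold_in; split=> /asboolP.
split.
- split; first by apply/UP; exists 0; rewrite mul0r.
  move=> a _ _ /UP[y ->] /UP[y' ->]; apply/UP; exists (a * y + y').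
  by rewrite mulrDl -mulrA.
- exists q; first by apply/UP; exists 1; rewrite mul1r.
  apply/eqP => /quotient_pi_eq0 /nilrad_nil [n en].
  case/eqP: e0; rewrite -[e]mulr1.
  suff <- : e ^+ n.+1 = e by rewrite exprS en !mulr0 mul0r.
  by elim: n {en} => // n IHn; rewrite exprS IHn.
- move=> V [V0 VL] VU.
  have [V_0|V_N] := pselect (forall z : Q^o, z \in V -> z = 0); [by left | right].
  have [z zV z0] : exists2 z : Q^o, z \in V & z != 0.
    apply: contrapT => noz; apply: V_N => z zV; apply/eqP.
    by apply: contrapT => /negP z0; apply: noz; exists z.
  have /UP[y yE] := VU z zV; have [x xE] := quotient_pi_surj y.
  have [|x' x'E] := primitive_mull e_prim (x := x).
    apply: contraNN z0 => xe; apply/eqP; rewrite yE -xE -rmorphM.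
    exact/quotient_pi_eq0.
  move=> _ /UP[u ->].
  have -> : u * q = (u * quotient_pi _ x') *: z + 0.
    rewrite addr0 yE -xE -rmorphM; rewrite /GRing.scale /=.
    by rewrite -mulrA -rmorphM x'E.
  exact: VL.
Qed.

(** Multiplying a decomposition of [1] into primitive idempotents by [z] writes
    [z] as a sum of elements of simple left ideals. The rank [rk] expresses
    that chains of idempotents below a given one have bounded length. *)
Lemma pi_regular_semiperfect (rk : R -> nat) :
  (forall f e, is_idempotent e -> sub_idempotent f e -> f != e ->
    (rk f < rk e)%N) -> semiperfect R.
Proof.
move=> rk_lt; split=> [|z]; first exact: nilrad_nil.
have [s [sE sP]] := idempotent_sum rk_lt (mulr1 1).
exists [seq (z : Q) * quotient_pi _ f | f <- s]; split.
  rewrite big_map -[LHS]mulr1 -(rmorph1 (quotient_pi (nilrad R))) sE.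
  by rewrite rmorph_sum mulr_sumr.
move=> _ /mapP[f /sP f_prim ->].
exists (left_multiples (quotient_pi (nilrad R) f)).
  exact: simple_left_multiples.
by rewrite unfold_in; apply/asboolP; exists z.
Qed.
End PiRegular.

(** * Functions with a finite dimensional orbit under a self-map *)

Lemma mx_annihilator (K : comNzRingType) n (M : 'M[K]_n) :
  exists2 p : {poly K}, p \is monic & \sum_(k < size p) p`_k *: M ^+ k = 0.
Proof.
case: n M => [|n] M.
  (* the only matrix without rows is already annihilated by [1] *)
  by exists 1; [exact: monic1 | apply/matrixP => -[]].
exists (char_poly M); first exact: char_poly_monic.
rewrite -[RHS](Cayley_Hamilton M) -[in RHS](coefK (char_poly M)) poly_def.
rewrite linear_sum /=; apply: eq_bigr => k _.
by rewrite linearZ /= rmorphXn /= horner_mx_X.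
Qed.

Section LocallyFinite.
Variables (K : fieldType) (T : Type) (phi : T -> T).
Implicit Types f g : T -> K.

(** The family [g] spans a space of functions stable under composition with
    [phi]. *)
Definition shift_family (I : finType) (g : I -> T -> K) :=
  exists c : I -> I -> K, forall i x, g i (phi x) = \sum_j c i j * g j x.

(** Membership in a finite dimensional space stable under composition with
    [phi]; a spanning family with structure constants is easier to combine than
    a subspace, since sums and products act on the index types. *)
Definition locally_finite f :=
  exists (I : finType) (g : I -> T -> K) (a : I -> K),
    shift_family g /\ forall x, f x = \sum_i a i * g i x.

(** Composition with [phi] acts on the family by a matrix, and any monic
    polynomial annihilating that matrix is a recurrence. *)
Lemma shift_family_recurrence (I : finType) (g : I -> T -> K) :
  shift_family g ->
  exists2 p : {poly K}, p \is monic &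
    forall i x, \sum_(k < size p) p`_k * g i (iter k phi x) = 0.
Proof.
case=> c gE.
pose M : 'M[K]_#|I| := \matrix_(i, j) c (enum_val i) (enum_val j).
pose G x : 'cV[K]_#|I| := \col_i g (enum_val i) x.
have GM x : G (phi x) = M *m G x.
  apply/colP=> i; rewrite !mxE gE (reindex_onto (@enum_val I predT) enum_rank) /=.
    by apply: eq_big => [j|j _]; rewrite ?mxE // enum_valK eqxx.
  by move=> j _; rewrite enum_rankK.
have GMk k x : G (iter k phi x) = M ^+ k *m G x.
  elim: k => [|k IHk] /=; first by rewrite expr0 mul1mx.
  by rewrite GM IHk exprS mulmxA.
have [p p_monic pM0] := mx_annihilator M.
exists p => // i x.
have G0: (0 *m G x) (enum_rank i) ord0 = 0 by rewrite mul0mx mxE.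
rewrite -[RHS]G0 -pM0 mulmx_suml summxE; apply: eq_bigr => k _.
by rewrite -scalemxAl -GMk !mxE enum_rankK.
Qed.

(** The recurrence being monic, each value is determined by the [N] previous
    ones. It is essential that [N] is chosen before the starting point [x]. *)
Lemma locally_finite_vanish f : locally_finite f ->
  exists N, forall x, (forall k, (k < N)%N -> f (iter k phi x) = 0) ->
    forall k, f (iter k phi x) = 0.
Proof.
case=> I [g [a [/shift_family_recurrence[p p_monic gp0] fE]]].
have fp0 x : \sum_(k < size p) p`_k * f (iter k phi x) = 0.
  under eq_bigr => k _ do rewrite fE mulr_sumr.
  rewrite exchange_big big1 //= => i _.
  by under eq_bigr => k _ do rewrite mulrCA; rewrite -mulr_sumr gp0 mulr0.
exists (size p).-1 => x f0; elim/ltn_ind => k IHk.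
have [/f0 // | le_pk] := ltnP k (size p).-1.
have := fp0 (iter (k - (size p).-1) phi x).
have {IHk}: forall j, (j < (size p).-1)%N ->
    f (iter j phi (iter (k - (size p).-1) phi x)) = 0.
  move=> j lt_jp; rewrite -iterD IHk // -{2}(subnKC le_pk) ltn_add2r //.
rewrite (polySpred (monic_neq0 p_monic)) /= => IHk.
rewrite big_ord_recr /= -lead_coefE (monicP p_monic) mul1r -iterD subnKC //.
by rewrite big1 ?add0r // => j _; rewrite IHk ?mulr0.
Qed.

Lemma locally_finite_ext f g : f =1 g -> locally_finite f -> locally_finite g.
Proof.
by move=> fg [I [h [a [hI fE]]]]; exists I, h, a; split=> // x; rewrite -fg.
Qed.

Lemma locally_finite_const (b : K) : locally_finite (fun=> b).
Proof.
exists 'I_1, (fun _ _ => 1), (fun=> b); split=> [|x].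
  by exists (fun _ _ => 1) => _ x; rewrite big_ord1 mulr1.
by rewrite big_ord1 mulr1.
Qed.

Lemma locally_finiteD f g :
  locally_finite f -> locally_finite g -> locally_finite (fun x => f x + g x).
Proof.
case=> I [u [a [[c uE] fE]]] [J [w [b [[d wE] gE]]]].
exists (I + J)%type, (fun s => match s with inl i => u i | inr j => w j end),
  (fun s => match s with inl i => a i | inr j => b j end).
split=> [|x]; last by rewrite big_sumType fE gE.
exists (fun s t => match s, t with
  inl i, inl i' => c i i' | inr j, inr j' => d j j' | _, _ => 0 end).
case=> [i|j] x; rewrite big_sumType /= ?uE ?wE.
  by rewrite [X in _ + X]big1 ?addr0 // => k _; rewrite mul0r.
by rewrite [X in X + _]big1 ?add0r // => k _; rewrite mul0r.
Qed.

Lemma locally_finiteM f g :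
  locally_finite f -> locally_finite g -> locally_finite (fun x => f x * g x).
Proof.
case=> I [u [a [[c uE] fE]]] [J [w [b [[d wE] gE]]]].
exists (I * J)%type, (fun s x => u s.1 x * w s.2 x), (fun s => a s.1 * b s.2).
split=> [|x].
  exists (fun s t => c s.1 t.1 * d s.2 t.2) => -[i j] x /=.
  rewrite uE wE big_distrlr pair_bigA /=.
  by apply: eq_bigr => s _; rewrite mulrACA.
by rewrite fE gE big_distrlr pair_bigA /=; apply: eq_bigr => s _; rewrite mulrACA.
Qed.

Lemma locally_finite_sum (I : Type) (r : seq I) (f : I -> T -> K) :
  (forall i, locally_finite (f i)) ->
  locally_finite (fun x => \sum_(i <- r) f i x).
Proof.
move=> fF; elim: r => [|i r IHr].
  by apply: locally_finite_ext (locally_finite_const 0) => x; rewrite big_nil.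
apply: locally_finite_ext (locally_finiteD (fF i) IHr) => x.
by rewrite big_cons.
Qed.

Lemma locally_finite_prod (I : Type) (r : seq I) (f : I -> T -> K) :
  (forall i, locally_finite (f i)) ->
  locally_finite (fun x => \prod_(i <- r) f i x).
Proof.
move=> fF; elim: r => [|i r IHr].
  by apply: locally_finite_ext (locally_finite_const 1) => x; rewrite big_nil.
apply: locally_finite_ext (locally_finiteM (fF i) IHr) => x.
by rewrite big_cons.
Qed.

Lemma locally_finite_meval n (f : 'I_n -> T -> K) (p : {mpoly K[n]}) :
  (forall i, locally_finite (f i)) -> locally_finite (fun x => p.@[f^~ x]).
Proof.
move=> fF; have fXF i k : locally_finite (fun x => f i x ^+ k).
  apply: locally_finite_ext (locally_finite_prod (index_enum 'I_k) (fun=> fF i)) => x.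
  by rewrite prodr_const card_ord.
apply: (@locally_finite_ext
  (fun x => \sum_(m <- msupp p) p@_m * \prod_(i < n) f i x ^+ m i)).
  by move=> x; rewrite mevalE.
apply: locally_finite_sum => m; apply: locally_finiteM.
  exact: locally_finite_const.
exact: locally_finite_prod.
Qed.

End LocallyFinite.

(** * Orbits of multiplication in Zariski-closed sets *)

Section Closed.
Variables (K : fieldType) (B : falgType K).
Variables (e : (\dim {:B}).-tuple B) (he : basis_of {:B} e).

Lemma coord_shift_family (v : B) :
  shift_family (fun x => v * x) (fun i x => coord e i x : K).
Proof.
exists (fun i j : 'I__ => coord e i (v * e`_j)) => i x.
rewrite {1}(coord_basis he (memvf x)) mulr_sumr linear_sum /=.
by apply: eq_bigr => j _; rewrite -scalerAr linearZ /= mulrC.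
Qed.

Lemma iter_mull (R : pzRingType) (v x : R) k : iter k ( *%R v) x = v ^+ k * x.
Proof. by elim: k => [|k IHk] /=; rewrite ?mul1r // IHk mulrA -exprS. Qed.

Lemma algebraic_elt (a : B) :
  exists2 p : {poly K}, p \is monic & \sum_(k < size p) p`_k *: a ^+ k = 0.
Proof.
have [p p_monic ap0] := shift_family_recurrence (coord_shift_family a).
exists p => //; apply/eqP; rewrite (coord_basis he (memvf (\sum_(k < _) _))).
rewrite big1 // => i _; rewrite linear_sum /= (eq_bigr _ (fun k _ => linearZ _ _)) /=.
rewrite [X in X *: _](_ : _ = 0) ?scale0r // -[RHS](ap0 i 1).
by apply: eq_bigr => k _; rewrite iter_mull mulr1.
Qed.

(** If [p] annihilates [a] and [r] is the least index of a nonzero coefficient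
    of [p], solving [p.[a] = 0] for [a ^+ r] exhibits it as a multiple of
    [a ^+ r.+1] by a polynomial in [a]. *)
Lemma falg_pi_regular : strongly_pi_regular B.
Proof.
move=> a; have [p p_monic ap0] := algebraic_elt a.
have ex_nz : exists k, p`_k != 0.
  by exists (size p).-1; rewrite -lead_coefE (monicP p_monic) oner_neq0.
case: (ex_minnP ex_nz) => r pr0 r_min {ex_nz}.
have lt_rp : (r < size p)%N.
  by rewrite ltnNge; apply: contraNN pr0 => /(nth_default 0)->.
have [d Dp] : exists d, size p = (r.+1 + d)%N.
  by exists (size p - r.+1)%N; rewrite subnKC.
exists r, (- \sum_(k < d) (p`_(r.+1 + k) / p`_r) *: a ^+ k); split.
  rewrite mulrN mulNr; congr (- _); apply: commr_sum => k _.
  rewrite /GRing.comm -scalerAr -scalerAl; congr (_ *: _).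
  exact: (commrX k (commr_refl a)).
apply: (scalerI pr0); rewrite mulrN scalerN; apply/eqP.
rewrite -addr_eq0 mulr_sumr scaler_sumr; apply/eqP.
move: ap0; rewrite Dp big_split_ord /= big_ord_recr /= big1 ?add0r => [ap0|i _].
  rewrite -[RHS]ap0; congr (_ + _); apply: eq_bigr => k _.
  by rewrite -scalerAr scalerA mulrCA divff // mulr1 -exprD.
have [->|/r_min] := eqVneq p`_i 0; first by rewrite scale0r.
by rewrite leqNgt ltn_ord.
Qed.

(** The equations of a closed set propagate along the orbit of [x] as soon as
    [x] can be reached from inside the set after arbitrarily many steps: the
    recurrence satisfied by each equation then starts from zeros. *)
Lemma zariski_closed_orbit (Z : set B) (v x : B) : zariski_closed e Z ->
  (forall N, exists y, (forall k, (k <= N)%N -> Z (v ^+ k * y)) /\ v ^+ N * y = x) ->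
  forall j, Z (v ^+ j * x).
Proof.
case=> P ZE Zx j; rewrite ZE /= => p Pp.
have pF : locally_finite ( *%R v) (fun x => p.@[fun i => coord e i x]).
  apply: locally_finite_meval => i.
  exists 'I_(\dim {:B}), (fun i x => coord e i x), (fun j => (i == j)%:R).
  split=> [|y]; first exact: coord_shift_family.
  rewrite (bigD1 i) //= eqxx mul1r big1 ?addr0 // => k.
  by rewrite eq_sym => /negPf->; rewrite mul0r.
have [N pN] := locally_finite_vanish pF; have [y [Zy <-]] := Zx N.
rewrite mulrA -exprD -iter_mull pN // => k /ltnW /Zy.
by rewrite ZE iter_mull => /(_ p Pp).
Qed.

(** With [v] taken from [falg_pi_regular], the element [v ^+ j * a ^+ r] plays
    the part of [a ^+ (r - j)], even for [j > r]; it stays in [Z], because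
    [a ^+ r] is the end of the orbit of [a ^+ (r + N)] after [N] steps inside
    [Z]. For [j = r.+1] it inverts [a] on the multiples of [a ^+ r]. *)
Lemma zariski_closed_pi_regular (Z : set B) (a : B) : zariski_closed e Z ->
  (forall k, Z (a ^+ k)) ->
  exists r (c : B), [/\ Z c, a * c = c * a & a ^+ r = a ^+ r.+1 * c].
Proof.
move=> Zc Za; have [r [v [av arv]]] := falg_pi_regular a.
have avk k : v ^+ k * a ^+ (r + k) = a ^+ r.
  elim: k => [|k IHk]; first by rewrite mul1r addn0.
  rewrite exprSr addnS -mulrA -[RHS]IHk; congr (_ * _).
  rewrite -addSn exprD mulrA (commrX _ (_ : GRing.comm v a)) //.
  by rewrite -arv exprD.
have cvv : GRing.comm a v by [].
exists r, (v ^+ r.+1 * a ^+ r); split.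
- apply: zariski_closed_orbit => // N; exists (a ^+ (r + N)); split => // k le_kN.
  by rewrite -(subnKC le_kN) addnA exprD mulrA avk -exprD.
- rewrite mulrA (commrX r.+1 cvv) -!mulrA; congr (_ * _).
  by rewrite -exprS exprSr.
- have -> : a ^+ r.+1 * (v ^+ r.+1 * a ^+ r) = v ^+ r.+1 * a ^+ r.+1 * a ^+ r.
    by rewrite mulrA; congr (_ * _); apply/commrX/commr_sym/commrX.
  by rewrite -mulrA -exprD addnC avk.
Qed.
End Closed.

(** * Semiperfectness *)

(** An inclusion [e * B <= f * B] would give [e = f * e = f]. *)
Lemma limg_amull_ltn (K : fieldType) (B : falgType K) (f e : B) :
  is_idempotent e -> sub_idempotent f e -> f != e ->
  (\dim (limg (amull f)) < \dim (limg (amull e)))%N.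
Proof.
move=> ee [ff fe ef] f_neq_e.
have imgP (g z : B) : reflect (exists y, z = g * y) (z \in limg (amull g)).
  apply: (iffP memv_imgP) => [[y _ ->]|[y ->]]; exists y;
  by rewrite ?lfunE ?memvf.
have sub_fe : (limg (amull f) <= limg (amull e))%VS.
  apply/subvP => _ /imgP[y ->]; apply/imgP; exists (f * y).
  by rewrite mulrA ef.
rewrite (ltn_leqif (dimv_leqif_sup sub_fe)); apply: contra_neqN f_neq_e.
move=> /subvP/(_ e) ef_sub.
have /imgP[y ey] : e \in limg (amull f).
  by apply: ef_sub; apply/imgP; exists 1; rewrite mulr1.
by rewrite -fe {1}ey mulrA ff.
Qed.

Theorem corollary3p30 (F : fieldType) (K : closedFieldType)
    (iota : {rmorphism F -> K}) (B : falgType K)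
    (e : (\dim {:B}).-tuple B) (he : basis_of {:B} e)
    (A : subalgClosed (restrict_scalars iota B))
    (hA : zariski_closed e [set x : B | x \in A]%classic) :
  semiperfect (subalgebra A).
Proof.
pose val_ (x : subalgebra A) : B := val x.
have valM x y : val_ (x * y) = val_ x * val_ y by [].
have valX x k : val_ (x ^+ k) = val_ x ^+ k.
  by elim: k => // k IHk; rewrite !exprS valM IHk.
have val_inj_ : injective val_ by exact: val_inj.
apply: (@pi_regular_semiperfect _ _ (fun x => \dim (limg (amull (val_ x))))).
  move=> a; have Aak k : [set x : B | x \in A]%classic (val_ a ^+ k).
    by rewrite -valX; exact: (valP (a ^+ k)).
  have [r [c [Ac ac ar]]] := zariski_closed_pi_regular he hA Aak.
  exists r, (Sub c Ac); split; apply: val_inj_; rewrite !valM ?valX //.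
move=> f g gg [ff fg gf] f_neq_g; apply: limg_amull_ltn.
- by rewrite /is_idempotent -valM gg.
- by split; rewrite ?/is_idempotent -valM ?ff ?fg ?gf.
- by apply: contra_neq f_neq_g => /val_inj_.
Qed.
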